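(* Suppose that $(\bar A,\bar B)$ is controllable, $(\bar A,\bar C_{\mathcal S})$ is observable, and $T_{\mathsf p}\ge n$. Let $(u,y)$ be an (online, attack-free) trajectory of $(\bar A,\bar B,\bar C)$ on times $k\ge-T_{\mathsf p}$ such that $u^{[-T_{\mathsf p},\tau_{\rm pe}-1]}$ is persistently exciting of order $2T_{\mathsf p}$ for some integer $\tau_{\rm pe}\ge0$, and set $\tau_{\rm sw}=\tau_{\rm pe}+1$, $F(\tau_{\rm sw})=Y_{\mathcal U}(\tau_{\rm sw})Z(\tau_{\rm sw})^\dagger$ ($\dagger$ the Moore–Penrose pseudoinverse), with $Z,Y_{\mathcal U}$ built from the online trajectory. Let $(\mathbf u,\mathbf y)$ be the attack-free offline input-output trajectory of the same system over $[0,N-1]$, and for $k\in[T_{\mathsf p},N-1]$ define $$\mathbf z(k)=\mathrm{col}\big(\mathbf u^{[k-T_{\mathsf p},k-1]},\,\mathbf y_{\mathcal S}^{[k-T_{\mathsf p},k-1]}\big)\in\mathbb R^{(m+|\mathcal S|)T_{\mathsf p}}.$$ Then the offline, attack-free, unprotected output is recovered as $\mathbf y_{\mathcal U}(k)=F(\tau_{\rm sw})\mathbf z(k)$ for all $k\in[T_{\mathsf p},N-1]$.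
   Context: The system is $x(k+1)=\bar Ax(k)+\bar Bu(k)$, $y(k)=\bar Cx(k)$ with $x(k)\in\mathbb R^n$, $u(k)\in\mathbb R^m$, $y(k)\in\mathbb R^p$. Output indices $\{1,\dots,p\}$ are partitioned into $\mathcal S$ (protected) and $\mathcal U$ (unprotected); $y_{\mathcal S},y_{\mathcal U}$ are the corresponding subvectors of $y$, and $\bar C_{\mathcal S}$ is the submatrix of rows of $\bar C$ indexed by $\mathcal S$. Offline, only $\mathbf u$ and $\mathbf y_{\mathcal S}$ are reliably stored; the stored version of $\mathbf y_{\mathcal U}$ may be arbitrarily corrupted (so $\mathbf z(k)$ is built only from reliable data). For a signal $v$, $v^{[i,j]}=\mathrm{col}(v(i),\dots,v(j))$, and $\mathscr H_q(v^{[i,j]})$ is the block Hankel matrix with $q$ block rows whose columns are $v^{[i,i+q-1]},v^{[i+1,i+q]},\dots,v^{[j-q+1,j]}$ ($q\le j-i+1$). $v^{[i,j]}$ is persistently exciting of order $q$ if $\mathscr H_q(v^{[i,j]})$ has full row rank. For the online trajectory and $k\ge0$ define $\zeta(k)=\mathrm{col}(u^{[k-T_{\mathsf p},k-1]},y_{\mathcal S}^{[k-T_{\mathsf p},k-1]})$; for $k\geq 1$, $Z(k)=[\zeta(0)\ \cdots\ \zeta(k-1)]$ and $Y_{\mathcal U}(k)=[y_{\mathcal U}(0)\ \cdots\ y_{\mathcal U}(k-1)]$. *)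

(* Defs.v *)
From HB Require Import structures.
From mathcomp Require Import all_boot all_order all_algebra.
From mathcomp Require Import reals.

Set Implicit Arguments.
Unset Strict Implicit.
Unset Printing Implicit Defensive.

Import Order.TTheory GRing.Theory Num.Theory.

Local Open Scope ring_scope.

(* Signals are total functions of an integer time.  Every notion below reads
   them only on an explicit time window, so their values elsewhere are
   irrelevant. *)

Section LinearSystems.
Variable R : realType.

Definition state_eq n m (A : 'M[R]_n) (B : 'M[R]_(n, m)) (K : interval int)
    (u : int -> 'cV[R]_m) (x : int -> 'cV[R]_n) : Prop :=
  forall k : int, k \in K -> x (k + 1) = A *m x k + B *m u k.

(* If K has a last instant k, the equation for x (k + 1) at that instant is no
   constraint: x (k + 1) is not used by any other equation. *)
Definition io_trajectory n m p (A : 'M[R]_n) (B : 'M[R]_(n, m))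
    (C : 'M[R]_(p, n)) (K : interval int)
    (u : int -> 'cV[R]_m) (y : int -> 'cV[R]_p) : Prop :=
  exists x : int -> 'cV[R]_n,
    state_eq A B K u x /\ (forall k : int, k \in K -> y k = C *m x k).

(* Every state can be steered to every state in finite time. *)
Definition controllable n m (A : 'M[R]_n) (B : 'M[R]_(n, m)) : Prop :=
  forall x0 x1 : 'cV[R]_n,
    exists (T : nat) (u : int -> 'cV[R]_m) (x : int -> 'cV[R]_n),
      [/\ state_eq A B `[0, T%:Z[ u x, x 0 = x0 & x T%:Z = x1].

(* The initial state is determined by the output of the unforced system. *)
Definition observable n p (A : 'M[R]_n) (C : 'M[R]_(p, n)) : Prop :=
  forall x x' : int -> 'cV[R]_n,
    (forall k : int, 0 <= k ->
       [/\ x (k + 1) = A *m x k, x' (k + 1) = A *m x' k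
         & C *m x k = C *m x' k]) ->
    x 0 = x' 0.

Definition of_cols d T (v : nat -> 'cV[R]_d) : 'M[R]_(d, T) :=
  \matrix_(i < d, j < T) v j i 0.

(* The stacked vector v^[i, i + q - 1]. *)
Definition window d (v : int -> 'cV[R]_d) (i : int) (q : nat) :
    'cV[R]_(\sum_(t < q) d) :=
  \mxcol_(t < q) v (i + t%:Z).

(* The block Hankel matrix with q block rows of v^[i, i + T - 1]; it has
   T - q + 1 columns. *)
Definition hankel d (v : int -> 'cV[R]_d) (i : int) (T q : nat) :
    'M[R]_(\sum_(t < q) d, T.+1 - q) :=
  of_cols (T.+1 - q) (fun j => window v (i + j%:Z) q).

(* v^[i, i + T - 1] is persistently exciting of order q. *)
Definition persistently_exciting d (v : int -> 'cV[R]_d) (i : int)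
    (T q : nat) : Prop :=
  (q <= T)%N /\ row_free (hankel v i T q).

(* The rows with index in S, in increasing order of index. *)
Definition subrows p q (S : {set 'I_p}) (M : 'M[R]_(p, q)) : 'M[R]_(#|S|, q) :=
  rowsub (fun i : 'I_#|S| => enum_val i) M.

(* col (u^[k - Tp, k - 1], y_S^[k - Tp, k - 1]): this is zeta (k) for the
   online trajectory and z (k) for the offline one. *)
Definition past_data m p (Tp : nat) (S : {set 'I_p})
    (u : int -> 'cV[R]_m) (y : int -> 'cV[R]_p) (k : int) :
    'cV[R]_(\sum_(t < Tp) m + \sum_(t < Tp) #|S|) :=
  col_mx (window u (k - Tp%:Z) Tp)
         (window (fun j => subrows S (y j)) (k - Tp%:Z) Tp).

Definition Z_mx m p (Tp : nat) (S : {set 'I_p})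
    (u : int -> 'cV[R]_m) (y : int -> 'cV[R]_p) (k : nat) :=
  of_cols k (fun j => past_data Tp S u y j%:Z).

(* For the unprotected outputs, S is the set of unprotected indices. *)
Definition Y_mx p (S : {set 'I_p}) (y : int -> 'cV[R]_p) (k : nat) :=
  of_cols k (fun j => subrows S (y j%:Z)).

(* The Penrose conditions. *)
Definition is_pinv a b (M : 'M[R]_(a, b)) (P : 'M[R]_(b, a)) : Prop :=
  [/\ M *m P *m M = M, P *m M *m P = P,
      (M *m P)^T = M *m P & (P *m M)^T = P *m M].

(* The Moore-Penrose pseudoinverse, from the full-rank factorization
   M = col_base M *m row_base M; see pinvP and is_pinv_unique. *)
Definition pinv a b (M : 'M[R]_(a, b)) : 'M[R]_(b, a) :=
  let L := col_base M in
  let G := row_base M in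
  G^T *m invmx (G *m G^T) *m (invmx (L^T *m L) *m L^T).

Lemma is_pinv_unique a b (M : 'M[R]_(a, b)) (P Q : 'M[R]_(b, a)) :
  is_pinv M P -> is_pinv M Q -> P = Q.
Proof.
move=> [P1 P2 P3 P4] [Q1 Q2 Q3 Q4].
have MPQ : M *m P = M *m Q.
  rewrite -P3 -{1}Q1 -(mulmxA (M *m Q)) trmx_mul P3 Q3.
  by rewrite mulmxA P1.
have PQM : P *m M = Q *m M.
  rewrite -P4 -{1}Q1 -(mulmxA M) mulmxA trmx_mul P4 Q4.
  by rewrite -mulmxA (mulmxA M) P1.
by rewrite -P2 PQM -mulmxA MPQ mulmxA Q2.
Qed.

Lemma gram_unitmx r b (G : 'M[R]_(r, b)) :
  row_free G -> G *m G^T \in unitmx.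
Proof.
move=> Gfree; rewrite -row_free_unit -kermx_eq0; apply/rowV0P => v.
move/sub_kermxP => vGG0.
have vG0 : v *m G = 0.
  apply/rowP => j; rewrite !mxE.
  have /matrixP/(_ 0 0) : (v *m G) *m (v *m G)^T = 0.
    by rewrite trmx_mul mulmxA -(mulmxA v) vGG0 mul0mx.
  rewrite !mxE => /eqP.
  rewrite psumr_eq0; last by move=> i _; rewrite !mxE -expr2 sqr_ge0.
  by move/allP/(_ j (mem_index_enum _)); rewrite !mxE -expr2 sqrf_eq0 => /eqP.
by apply: (row_free_inj Gfree); rewrite vG0 mul0mx.
Qed.

Lemma pinv_factor a b r (L : 'M[R]_(a, r)) (G : 'M[R]_(r, b)) :
  row_free G -> row_full L ->
  is_pinv (L *m G)
    (G^T *m invmx (G *m G^T) *m (invmx (L^T *m L) *m L^T)).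
Proof.
move=> Gfree Lfull.
have GU : G *m G^T \in unitmx by rewrite gram_unitmx.
have LU : L^T *m L \in unitmx.
  have LF : row_free L^T by rewrite /row_free mxrank_tr.
  by have := gram_unitmx LF; rewrite trmxK.
set X := G^T *m _; set Y := _ *m L^T.
have GX : G *m X = 1%:M by rewrite /X mulmxA mulmxV.
have YL : Y *m L = 1%:M by rewrite /Y -mulmxA mulVmx.
have MP : L *m G *m (X *m Y) = L *m Y.
  by rewrite mulmxA -(mulmxA L) GX mulmx1.
have PM : X *m Y *m (L *m G) = X *m G.
  by rewrite mulmxA -(mulmxA X) YL mulmx1.
split.
- by rewrite MP mulmxA -(mulmxA L) YL mulmx1.
- by rewrite PM mulmxA -(mulmxA X) GX mulmx1.
- by rewrite MP /Y !trmx_mul trmx_inv trmx_mul trmxK !mulmxA.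
- by rewrite PM /X !trmx_mul trmx_inv trmx_mul trmxK !mulmxA.
Qed.

Lemma pinvP a b (M : 'M[R]_(a, b)) : is_pinv M (pinv M).
Proof.
have := pinv_factor (row_base_free M) (col_base_full M).
by rewrite mulmx_base.
Qed.

End LinearSystems.

(* Main.v *)
Require Import Defs.
From HB Require Import structures.
From mathcomp Require Import all_boot all_order all_algebra.
From mathcomp Require Import reals zify.

Set Implicit Arguments.
Unset Strict Implicit.
Unset Printing Implicit Defensive.

Import Order.TTheory GRing.Theory Num.Theory.
Local Open Scope ring_scope.

(** By Willems' fundamental lemma, persistency of excitation of order Tp + d
    with d >= n makes the input windows of length Tp together with their initial
    states span everything, so the offline data over [k - Tp, k] are a linear
    combination, with coefficient vector c, of the online data; hence
    z k = Z c and y_U k = Y c.  Observability makes a combination of online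
    trajectories with zero past vanish, so Z c' = 0 implies Y c' = 0; applied to
    c' = c - Z^+ Z c, this gives Y c = Y Z^+ Z c = F z.  Since Tp >= n, the
    hypothesis of order 2 Tp is the case d = Tp. *)

(** * Powers of a matrix and elimination of the state *)

(** Cayley-Hamilton gives the case [d = n]; each further multiplication by [A] shifts the
    coefficients by one. *)
Lemma expmx_recurrence (F : comNzRingType) n (A : 'M[F]_n) d :
  (n <= d)%N ->
  exists alpha : nat -> F, A ^+ d = \sum_(r < d) alpha r *: A ^+ r.
Proof.
move=> /subnK <-; elim: (d - n)%N => [|e [alpha IH]]; last first.
  exists (fun r => if r is r'.+1 then alpha r' else 0).
  rewrite addSn exprS IH big_ord_recl scale0r add0r mulr_sumr.
  by apply: eq_bigr => r _; rewrite -[LHS]scalemxAr exprS.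
rewrite add0n; case: n A => [|n] A.
  by exists (fun=> 0); rewrite flatmx0; apply/matrixP => -[].
exists (fun r => - (char_poly A)`_r).
have := Cayley_Hamilton A.
rewrite -{1}[char_poly A]coefK poly_def size_char_poly raddf_sum /=.
rewrite big_ord_recr /=.
have -> : (char_poly A)`_n.+1 = 1.
  by have /monicP := char_poly_monic A; rewrite lead_coefE size_char_poly.
rewrite scale1r rmorphXn /= horner_mx_X => /eqP.
rewrite addrC addr_eq0 => /eqP ->.
rewrite -sumrN; apply: eq_bigr => r _.
by rewrite linearZ /= rmorphXn /= horner_mx_X scaleNr.
Qed.

Section Kernel.
Variables (F : comNzRingType) (n m : nat) (A : 'M[F]_n) (B : 'M[F]_(n, m)).
Variables (L : nat) (xi : nat -> 'rV[F]_m) (eta : 'rV[F]_n).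

(* If (xi, eta) annihilates the windows (u, x), so does the same functional
   shifted by r steps; the state equation then moves eta back to the start of
   the window, at the price of the input coefficients eta A^i B.  All shifts
   share the following coefficients, in which index 0 is attached to the latest
   input. *)
Definition pushback (a : nat) : 'rV[F]_m :=
  if (a < L)%N then xi (L.-1 - a) else eta *m A ^+ (a - L) *m B.

Variables (T : nat) (u : nat -> 'cV[F]_m) (x : nat -> 'cV[F]_n).
Hypothesis hx : forall k, (k < T)%N -> x k.+1 = A *m x k + B *m u k.
Hypothesis hann : forall j, (j + L <= T)%N ->
  \sum_(t < L) xi t *m u (j + t)%N + eta *m x j = 0.

Lemma pushback_annihilates r j : (j + (L + r) <= T)%N ->
  \sum_(t < L + r) pushback ((L + r).-1 - t) *m u (j + t)%N
    + eta *m A ^+ r *m x j = 0.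
Proof.
elim: r j => [|r IH] j jT.
  rewrite addn0 in jT *; rewrite expr0 mulmx1 -[RHS](hann jT); congr (_ + _).
  apply: eq_bigr => t _; congr (_ *m _); rewrite /pushback.
  have tL := ltn_ord t.
  by rewrite ifT; [congr xi; lia | lia].
have jT' : (j.+1 + (L + r) <= T)%N by lia.
(* The state equation splits [x j.+1]; its input part [eta *m A ^+ r *m B *m u j] is the new summand
   [t = 0], with coefficient [pushback (L + r)]. *)
rewrite -[RHS](IH _ jT') hx; last by lia.
rewrite addnS big_ord_recl /= subn0 addn0 addrAC [RHS]addrC; congr (_ + _).
  rewrite exprSr mulmxDr !mulmxA addrC; congr (_ + _ *m _).
  rewrite /pushback ifF; last by lia.
  by rewrite addKn.
apply: eq_bigr => t _; rewrite /bump add1n addSnnS.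
by congr (pushback _ *m _); lia.
Qed.

Variables (d : nat) (alpha : nat -> F).
Hypothesis hA : A ^+ d = \sum_(r < d) alpha r *: A ^+ r.

(* The relation A ^+ d = \sum_r alpha r *: A ^+ r between the shifts r <= d
   eliminates the state; these are the remaining input coefficients. *)
Definition hankel_annihilator (t : nat) : 'rV[F]_m :=
  pushback ((L + d).-1 - t)
    - \sum_(r < d | (t < L + r)%N) alpha r *: pushback ((L + r).-1 - t).

Lemma hankel_annihilatorP j : (j + (L + d) <= T)%N ->
  \sum_(t < L + d) hankel_annihilator t *m u (j + t)%N = 0.
Proof.
move=> jT.
under eq_bigr do rewrite mulmxBl mulmx_suml.
rewrite sumrB (exchange_big_dep xpredT) //=.
have := pushback_annihilates jT.
rewrite hA mulmx_sumr mulmx_suml => /eqP; rewrite addr_eq0 => /eqP ->.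
rewrite -opprD -big_split big1 ?oppr0 //= => r _.
have jr : (j + (L + r) <= T)%N by have := ltn_ord r; lia.
rewrite -scalemxAr -scalemxAl.
under [X in _ + X]eq_bigr do rewrite -scalemxAl.
rewrite -scaler_sumr -scalerDr.
rewrite -(big_ord_widen (L + d)
  (fun t => pushback ((L + r).-1 - t) *m u (j + t)%N)).
  by rewrite addrC pushback_annihilates ?scaler0.
by have := ltn_ord r; lia.
Qed.

(** The system is triangular: at [t = (L + d).-1 - a] the coefficient is [pushback a] minus a
    combination of values [pushback (a - (d - r))] with [r < d]. *)
Lemma hankel_annihilator_eq0 :
  (forall t, (t < L + d)%N -> hankel_annihilator t = 0) ->
  forall a, (a < L + d)%N -> pushback a = 0.
Proof.
move=> h0; elim/ltn_ind => a IH aLd.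
have /h0 : ((L + d).-1 - a < L + d)%N by lia.
rewrite /hankel_annihilator subKn; last by lia.
rewrite big1 ?subr0 // => r hr; rewrite IH ?scaler0 //; have := ltn_ord r; lia.
Qed.

End Kernel.

(** For [k >= d] the recurrence reduces [A ^+ k] to the lower powers [A ^+ (k - d + r)].
    Controllability uses this with [Q := B], observability with [P := C]. *)
Lemma expmx_span_eq0 (F : comNzRingType) n a b (A : 'M[F]_n)
    (P : 'M[F]_(a, n)) (Q : 'M[F]_(n, b)) d :
  (n <= d)%N -> (forall r, (r < d)%N -> P *m A ^+ r *m Q = 0) ->
  forall k, P *m A ^+ k *m Q = 0.
Proof.
move=> /(expmx_recurrence A) [alpha hA] h0; elim/ltn_ind => k IH.
have [/h0 //|dk] := ltnP k d.
rewrite -(subnK dk) exprD hA mulr_sumr mulmx_sumr mulmx_suml big1 // => r _.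
have rd := ltn_ord r.
rewrite -[A ^+ (k - d) * _]scalemxAr mulmxE -exprD -scalemxAr -scalemxAl.
by rewrite IH ?scaler0 //; lia.
Qed.

(** * Controllability, observability and persistency of excitation *)

Section Trajectories.
Variable R : realType.

(** Along a trajectory from 0 each [eta *m A ^+ k] keeps annihilating the state, since inputs enter
    only through [eta *m A ^+ k *m B]; controllability reaches every basis vector. *)
Lemma controllable_left_kernel n m (A : 'M[R]_n) (B : 'M[R]_(n, m))
    (eta : 'rV[R]_n) :
  controllable A B -> (forall k, eta *m A ^+ k *m B = 0) -> eta = 0.
Proof.
move=> hctrl hk; apply/rowP => j.
have [T [u [x [hx x0 xT]]]] := hctrl 0 (delta_mx j 0).
have h : forall t k : nat, (t <= T)%N -> eta *m A ^+ k *m x t%:Z = 0.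
  elim=> [|t IH] k tT; first by rewrite x0 mulmx0.
  have -> : t.+1%:Z = t%:Z + 1 by lia.
  rewrite hx; last by rewrite in_itv /=; lia.
  rewrite mulmxDr (mulmxA _ B) hk mul0mx addr0 mulmxA -(mulmxA eta).
  by rewrite mulmxE -exprSr IH // ltnW.
have /matrixP/(_ 0 0) := h T 0%N (leqnn _).
by rewrite xT expr0 mulmx1 -colE !mxE.
Qed.

Lemma observable_right_kernel n p (A : 'M[R]_n) (C : 'M[R]_(p, n)) d
    (v : 'cV[R]_n) :
  observable A C -> (n <= d)%N ->
  (forall r, (r < d)%N -> C *m A ^+ r *m v = 0) -> v = 0.
Proof.
move=> hobs nd /(expmx_span_eq0 nd) h.
(* The unforced trajectory from [v] is compared with the zero one; the absolute value only extends
   it to negative times. *)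
have := hobs (fun k => A ^+ `|k|%N *m v) (fun=> 0).
rewrite expr0 mul1mx; apply=> k k0; split; rewrite ?mulmx0 ?mulmxA ?h //.
by rewrite mulmxE -exprS; congr (A ^+ _ *m v); lia.
Qed.

Lemma of_cols_mulmx d T (v : nat -> 'cV[R]_d) (c : 'cV[R]_T) :
  of_cols T v *m c = \sum_j c j 0 *: v j.
Proof.
apply/colP => a; rewrite mxE summxE; apply: eq_bigr => j _.
by rewrite !mxE mulrC.
Qed.

Lemma of_cols_col_mx d e T (v : nat -> 'cV[R]_d) (w : nat -> 'cV[R]_e) :
  of_cols T (fun j => col_mx (v j) (w j)) = col_mx (of_cols T v) (of_cols T w).
Proof.
apply/matrixP => a j; rewrite mxE -[a]splitK.
by case: (split a) => b /=; rewrite ?col_mxEu ?col_mxEd mxE.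
Qed.

Lemma window_eq d (v v' : int -> 'cV[R]_d) i i' q T (c : 'cV[R]_T) :
  window v' i' q = of_cols T (fun j => window v (i + j%:Z) q) *m c <->
  forall t, (t < q)%N ->
    v' (i' + t%:Z) = \sum_j c j 0 *: v (i + (j + t)%N%:Z).
Proof.
have submxcolZ (a : R) (M : 'cV[R]_(\sum_(t < q) d)) t :
    submxcol (a *: M) t = a *: submxcol M t.
  by apply/matrixP => r s; rewrite !mxE.
have E (t : 'I_q) : submxcol
    (of_cols T (fun j => window v (i + j%:Z) q) *m c) t =
    \sum_j c j 0 *: v (i + (j + t)%N%:Z).
  rewrite of_cols_mulmx submxcol_sum; apply: eq_bigr => j _.
  by rewrite submxcolZ mxcolK PoszD addrA.
rewrite -mxcolP; split=> h t.
  by move=> tq; have := h (Ordinal tq); rewrite E mxcolK.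
by rewrite E mxcolK h.
Qed.

Lemma mxrow_mul_hankel m (u : int -> 'cV[R]_m) i T q (xi : 'I_q -> 'rV[R]_m) j :
  ((\mxrow_t xi t) *m hankel u i T q) 0 j =
  (\sum_t xi t *m u (i + (j + t)%N%:Z)) 0 0.
Proof.
under [in RHS]eq_bigr do rewrite PoszD addrA.
rewrite -(mul_mxrow_mxcol xi (fun s : 'I_q => u (i + j%:Z + s%:Z))) !mxE.
by apply: eq_bigr => s _; rewrite [hankel _ _ _ _ _ _]mxE.
Qed.

Lemma persistently_exciting_left_kernel m (u : int -> 'cV[R]_m) i T q
    (xi : nat -> 'rV[R]_m) :
  persistently_exciting u i T q ->
  (forall j, (j + q <= T)%N ->
     \sum_(t < q) xi t *m u (i + (j + t)%N%:Z) = 0) ->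
  forall t, (t < q)%N -> xi t = 0.
Proof.
move=> [qT free] h t tq.
have : (\mxrow_(s < q) xi s) *m hankel u i T q = 0 *m hankel u i T q.
  rewrite mul0mx; apply/rowP => j; rewrite mxrow_mul_hankel h ?mxE //.
  by have := ltn_ord j; lia.
move/(row_free_inj free) => /(congr1 (fun M => submxrow M (Ordinal tq))).
by rewrite mxrowK submxrow0.
Qed.

(* Willems' fundamental lemma. *)
Lemma row_free_input_state n m (A : 'M[R]_n) (B : 'M[R]_(n, m)) (i : int) T L d
    (u : int -> 'cV[R]_m) (x : int -> 'cV[R]_n) :
  controllable A B -> (n <= d)%N ->
  (forall k : nat, (k < T)%N ->
     x (i + k.+1%:Z) = A *m x (i + k%:Z) + B *m u (i + k%:Z)) ->
  persistently_exciting u i T (L + d) ->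
  row_free (col_mx (hankel u i T L)
                   (of_cols (T.+1 - L) (fun j => x (i + j%:Z)))).
Proof.
move=> hctrl nd hx hpe; rewrite -kermx_eq0; apply/rowV0P => v /sub_kermxP.
rewrite -[v]hsubmxK -[lsubmx v]submxrowK.
set eta := rsubmx v; set xi_ := submxrow _ => vW.
pose xi t := if insub t is Some s then xi_ s else 0.
have xiE (s : 'I_L) : xi s = xi_ s by rewrite /xi valK.
have hann j : (j + L <= T)%N ->
    \sum_(t < L) xi t *m u (i + (j + t)%N%:Z) + eta *m x (i + j%:Z) = 0.
  move=> jT; have jT' : (j < T.+1 - L)%N by lia.
  have /matrixP/(_ 0 (Ordinal jT')) := vW.
  rewrite mul_row_col mxE mxrow_mul_hankel [RHS]mxE => e.
  apply/matrixP => a b; rewrite !ord1 [RHS]mxE -[RHS]e mxE.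
  under eq_bigr do rewrite xiE.
  congr (_ + _); rewrite !mxE.
  by apply: eq_bigr => s _; rewrite [of_cols _ _ _ _]mxE.
have [alpha hA] := expmx_recurrence A nd.
(* Excitation of order [L + d] makes [pushback] vanish below [L + d]: the first [L] values are the
   blocks of [xi], the other [d] are [eta *m A ^+ r *m B]. *)
have push0 := hankel_annihilator_eq0 (persistently_exciting_left_kernel hpe
  (hankel_annihilatorP hx hann hA)).
have xi0 s : xi_ s = 0.
  have sL := ltn_ord s.
  have aL : (L.-1 - s < L)%N by lia.
  have /push0 : (L.-1 - s < L + d)%N by lia.
  by rewrite /pushback aL subKn ?xiE //; lia.
have -> : eta = 0.
  apply: (controllable_left_kernel hctrl); apply: (expmx_span_eq0 nd) => r rd.
  have /push0 : (L + r < L + d)%N by lia.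
  by rewrite /pushback ifF ?addKn //; lia.
rewrite [\mxrow_j _](_ : _ = 0) ?row_mx0 //.
by apply/mxrowP => s; rewrite mxrowK xi0 submxrow0.
Qed.

(** Equality of stacked data becomes equality of signals at each instant, where the state equation
    can be applied. *)
Lemma past_data_eq m p Tp (S : {set 'I_p}) (u u' : int -> 'cV[R]_m)
    (y y' : int -> 'cV[R]_p) k T (c : 'cV[R]_T) :
  past_data Tp S u' y' k = Z_mx Tp S u y T *m c <->
  forall t, (t < Tp)%N ->
    u' (k - Tp%:Z + t%:Z) = \sum_j c j 0 *: u (- Tp%:Z + (j + t)%N%:Z) /\
    subrows S (y' (k - Tp%:Z + t%:Z)) =
      subrows S (\sum_j c j 0 *: y (- Tp%:Z + (j + t)%N%:Z)).
Proof.
have subrowsE t : subrows S (\sum_j c j 0 *: y (- Tp%:Z + (j + t)%N%:Z)) =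
    \sum_j c j 0 *: subrows S (y (- Tp%:Z + (j + t)%N%:Z)).
  apply/colP => a; rewrite mxE !summxE; apply: eq_bigr => j _.
  by rewrite !mxE.
have -> : Z_mx Tp S u y T =
    col_mx (of_cols T (fun j => window u (- Tp%:Z + j%:Z) Tp))
      (of_cols T (fun j =>
        window (fun j => subrows S (y j)) (- Tp%:Z + j%:Z) Tp)).
  rewrite -of_cols_col_mx; apply/matrixP => a j; rewrite !mxE.
  by rewrite /past_data addrC.
rewrite mul_col_mx /past_data; split.
  move=> /eq_col_mx[/window_eq hu /window_eq hy].
  by move=> t tTp; rewrite hu // hy // subrowsE.
by move=> h; congr col_mx; apply/window_eq => t /h[hu hy]; rewrite ?hu // hy subrowsE.
Qed.

Section FreeResponse.
Variables (n m p : nat) (A : 'M[R]_n) (B : 'M[R]_(n, m)) (C : 'M[R]_(p, n)).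
Variables (T : nat) (u : nat -> 'cV[R]_m) (x : nat -> 'cV[R]_n).
Hypothesis hx : forall t, (t < T)%N -> x t.+1 = A *m x t + B *m u t.
Hypothesis hu : forall t, (t < T)%N -> u t = 0.

Lemma free_response t : (t <= T)%N -> x t = A ^+ t *m x 0%N.
Proof.
elim: t => [|t IH] tT; first by rewrite expr0 mul1mx.
by rewrite hx // hu // mulmx0 addr0 IH ?(ltnW tT) // mulmxA mulmxE exprS.
Qed.

(** With zero input, [T >= n] zero outputs force [x 0 = 0] by observability, and the free response
    carries this to time [T]. *)
Lemma zero_output_zero_state : observable A C -> (n <= T)%N ->
  (forall t, (t < T)%N -> C *m x t = 0) -> x T = 0.
Proof.
move=> hobs nT hC; rewrite free_response //.
rewrite (observable_right_kernel (v := x 0%N) hobs nT).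
  by rewrite mulmx0.
by move=> t tT; rewrite -mulmxA -free_response ?hC // ltnW.
Qed.

End FreeResponse.

End Trajectories.

(** * Recovery of the unprotected output from past data *)

Theorem corollary1 (R : realType) (n m p : nat)
    (A : 'M[R]_n) (B : 'M[R]_(n, m)) (C : 'M[R]_(p, n))
    (S U : {set 'I_p}) (Tp tau_pe N : nat)
    (u : int -> 'cV[R]_m) (y : int -> 'cV[R]_p)
    (u_off : int -> 'cV[R]_m) (y_off : int -> 'cV[R]_p)
    (hU : U = ~: S)
    (hctrl : controllable A B)
    (hobs : observable A (subrows S C))
    (hTp : (n <= Tp)%N)
    (honline : io_trajectory A B C `[- Tp%:Z, +oo[ u y)
    (hpe : persistently_exciting u (- Tp%:Z) (Tp + tau_pe) (2 * Tp))
    (hoffline : io_trajectory A B C `[0, N%:Z - 1] u_off y_off) :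
  let tau_sw := tau_pe.+1 in
  let F := Y_mx U y tau_sw *m pinv (Z_mx Tp S u y tau_sw) in
  forall k : int, k \in `[Tp%:Z, N%:Z - 1] ->
    subrows U (y_off k) = F *m past_data Tp S u_off y_off k.
Proof.
move=> tau F k; rewrite in_itv /= => /andP[Tpk kN].
have [x [hx hy]] := honline; have [x' [hx' hy']] := hoffline.
have {}hx (t : nat) : x (- Tp%:Z + t.+1%:Z) =
    A *m x (- Tp%:Z + t%:Z) + B *m u (- Tp%:Z + t%:Z).
  by rewrite -hx ?in_itv /=; [congr x; lia | lia].
have {}hy (t : nat) : y (- Tp%:Z + t%:Z) = C *m x (- Tp%:Z + t%:Z).
  by rewrite hy // in_itv /=; lia.
have {}hx' t : (t < Tp)%N -> x' (k - Tp%:Z + t.+1%:Z) =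
    A *m x' (k - Tp%:Z + t%:Z) + B *m u_off (k - Tp%:Z + t%:Z).
  by move=> tTp; rewrite -hx' ?in_itv /=; [congr x'; lia | lia].
(* The bound includes [t = Tp], which is the instant [k] of the output to be recovered. *)
have {}hy' t : (t <= Tp)%N -> y_off (k - Tp%:Z + t%:Z) =
    C *m x' (k - Tp%:Z + t%:Z).
  by move=> tTp; rewrite hy' // in_itv /=; lia.
(* By linearity, combining the shifted online trajectories with weights [c] gives a trajectory of
   the same system, whose time [t = Tp] corresponds to the columns of [Y_mx]. *)
pose X (c : 'cV[R]_tau) t := \sum_j c j 0 *: x (- Tp%:Z + (j + t)%N%:Z).
pose V (c : 'cV[R]_tau) t := \sum_j c j 0 *: u (- Tp%:Z + (j + t)%N%:Z).
have hX c t : X c t.+1 = A *m X c t + B *m V c t.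
  rewrite !mulmx_sumr -big_split; apply: eq_bigr => j _ /=.
  by rewrite addnS hx scalerDr !scalemxAr.
have hY (c : 'cV[R]_tau) t :
    \sum_j c j 0 *: y (- Tp%:Z + (j + t)%N%:Z) = C *m X c t.
  by rewrite mulmx_sumr; apply: eq_bigr => j _; rewrite hy scalemxAr.
have subrowsM (W : {set 'I_p}) v : subrows W (C *m v) = subrows W C *m v.
  by rewrite /subrows -mul_rowsub_mx.
have YE c : Y_mx U y tau *m c = subrows U C *m X c Tp.
  rewrite of_cols_mulmx -subrowsM -hY; apply/colP => a.
  rewrite mxE !summxE; apply: eq_bigr => j _; rewrite !mxE.
  by congr (_ * y _ _ _); lia.
have YZ (c : 'cV[R]_tau) : Z_mx Tp S u y tau *m c = 0 -> Y_mx U y tau *m c = 0.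
  move=> Zc0; have := past_data_eq Tp S u (fun=> 0) y (fun=> 0) k c.
  rewrite Zc0 => -[past0 _]; rewrite YE.
  have /past0 {}past0 : past_data Tp S (fun=> 0) (fun=> 0) k =
      0 :> 'cV[R]_(\sum_(t < Tp) m + \sum_(t < Tp) #|S|).
    by apply/colP => a; rewrite mxE; case: split => b; rewrite !mxE.
  rewrite (zero_output_zero_state (fun t _ => hX c t) _ hobs hTp) ?mulmx0 //.
    by move=> t /past0[].
  move=> t /past0[_]; rewrite hY subrowsM => <-.
  by apply/matrixP => a b; rewrite !mxE.
have [c [hw h0]] : exists c : 'cV[R]_tau,
    window u_off (k - Tp%:Z) Tp =
      of_cols tau (fun j => window u (- Tp%:Z + j%:Z) Tp) *m c
    /\ x' (k - Tp%:Z) = X c 0%N.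
  (* The order [2 * Tp] is split as window length [L = Tp] plus [d = Tp]. *)
  rewrite mul2n -addnn in hpe.
  have := row_free_input_state hctrl hTp (fun t _ => hx t) hpe.
  (* The Hankel matrix has [(Tp + tau_pe).+1 - Tp = tau] columns, as many as [Z_mx]; full row rank
     provides a right inverse [W'], hence [c]. *)
  rewrite /hankel -addnS addKn => /row_freeP[W' WW'].
  exists (W' *m col_mx (window u_off (k - Tp%:Z) Tp) (x' (k - Tp%:Z))).
  set c := W' *m _.
  have : col_mx (window u_off (k - Tp%:Z) Tp) (x' (k - Tp%:Z)) =
      col_mx (of_cols tau (fun j => window u (- Tp%:Z + j%:Z) Tp))
        (of_cols tau (fun j => x (- Tp%:Z + j%:Z))) *m c.
    by rewrite mulmxA WW' mul1mx.
  rewrite mul_col_mx => /eq_col_mx[-> ->]; split=> //.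
  by rewrite of_cols_mulmx; apply: eq_bigr => j _; rewrite addn0.
have {hw}/window_eq hw := hw.
have hx0 t : (t <= Tp)%N -> x' (k - Tp%:Z + t%:Z) = X c t.
  elim: t => [|t IH] tTp; first by rewrite addr0.
  by rewrite hx' // IH ?(ltnW tTp) // hw // hX.
have -> : past_data Tp S u_off y_off k = Z_mx Tp S u y tau *m c.
  apply/past_data_eq => t tTp; split; first exact: hw.
  by rewrite hy' ?(ltnW tTp) // hY hx0 // ltnW.
have -> : subrows U (y_off k) = Y_mx U y tau *m c.
  by rewrite YE -subrowsM -hx0 // -hy' //; congr (subrows U (y_off _)); lia.
(* The difference is [Y_mx] applied to [c] minus its image under pseudoinverse times [Z_mx], a
   vector in the kernel of [Z_mx] by the first Penrose condition. *)
apply/eqP; rewrite -subr_eq0 /F -mulmxA -mulmxBr; apply/eqP/YZ.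
have := pinvP (Z_mx Tp S u y tau); move: (pinv _) => P [ZPZ _ _ _].
by rewrite mulmxBr !mulmxA ZPZ subrr.
Qed.
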